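(* Let $s\ge1$ be an integer, let $q_2=x_1^2+x_2^2$, and set $$r=2(s+1)^{-\frac{1}{2s}}\binom{2s}{s}^{-\frac{1}{2s}},\qquad \tau_j=\frac{(j-1)\pi}{s+1}\quad(j=1,\dots,s+1).$$ Then $q_2^s$ has a decomposition of the minimal size $s+1$ that is unique up to complex orthogonal transformations, namely the real decomposition $$q_2^s=\sum_{j=1}^{s+1}\bigl(r\cos(\tau_j)x_1+r\sin(\tau_j)x_2\bigr)^{2s},$$ whose terms are given by the pairs of opposite vertices of a regular $2(s+1)$-gon inscribed in a circle of radius $r$. That is, this identity holds, and whenever $q_2^s=\sum_{j=1}^{s+1}\ell_j^{2s}$ with $\ell_1,\dots,\ell_{s+1}$ complex linear forms in $x_1,x_2$, there is a matrix $A\in\mathrm{O}_2(\mathbb{C})$, acting by linear change of variables, such that, after reordering, $(A\cdot\ell_j)^{2s}=\bigl(r\cos(\tau_j)x_1+r\sin(\tau_j)x_2\bigr)^{2s}$ for every $j=1,\dots,s+1$.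
   Context: $\mathrm{O}_2(\mathbb{C})$ is the group of complex $2\times2$ matrices $A$ with $A^{\mathsf T}A=I$; it acts on $\mathbb{C}[x_1,x_2]$ by linear change of variables and fixes $q_2$. The minimal number of summands in an expression of $q_2^s$ as a sum of $2s$-th powers of complex linear forms is $s+1$. *)

(* Defs.v *)
From mathcomp Require Export all_boot all_order all_algebra all_fingroup.
From mathcomp Require Export mpoly complex reals exp trigo.

Set Implicit Arguments.
Unset Strict Implicit.
Unset Printing Implicit Defensive.

Import Order.TTheory GRing.Theory Num.Theory.

Local Open Scope ring_scope.
Local Open Scope complex_scope.

Definition x1 {R : realType} : {mpoly R[i][2]} := 'X_ord0.
Definition x2 {R : realType} : {mpoly R[i][2]} := 'X_ord_max.

Definition q2 (R : realType) : {mpoly R[i][2]} := x1 ^+ 2 + x2 ^+ 2.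

(* The zero form is 1-homogeneous, so vanishing summands are allowed. *)
Definition is_power_decomposition (R : realType) (d k : nat)
    (f : {mpoly R[i][2]}) (ell : 'I_k -> {mpoly R[i][2]}) : Prop :=
  (forall j, ell j \is 1.-homog) /\ f = \sum_(j < k) ell j ^+ d.

Definition orthogonal_mx (F : comNzRingType) (n : nat) : pred 'M[F]_n :=
  fun A => A^T *m A == 1%:M.

(* (A . f)(x) = f(A^T x), a left action of all matrices; for A orthogonal it is
   f(A^-1 x), and it sends the linear form with coefficient vector v to the one
   with coefficient vector A v. *)
Definition linear_change (F : comNzRingType) (n : nat)
    (A : 'M[F]_n) (f : {mpoly F[n]}) : {mpoly F[n]} :=
  f \mPo [tuple \sum_(k < n) A k i *: 'X_k | i < n].

Definition radius (R : realType) (s : nat) : R :=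
  2 * s.+1%:R `^ (- (1 / (2 * s%:R))) * 'C(2 * s, s)%:R `^ (- (1 / (2 * s%:R))).

(* Indices start at 0, so this is tau_(j+1). *)
Definition tau (R : realType) (s j : nat) : R := j%:R * pi / s.+1%:R.

Definition tau_point (R : realType) (s j : nat) : R * R :=
  (radius R s * cos (tau R s j), radius R s * sin (tau R s j)).

Definition real_linear_form (R : realType) (p : R * R) : {mpoly R[i][2]} :=
  p.1%:C *: x1 + p.2%:C *: x2.

(* The k-th vertex of the regular N-gon inscribed in the circle of radius rho
   centred at the origin, with 0-th vertex (rho, 0); for N even, the vertex
   opposite to the k-th one is the (k + N/2)-th. *)
Definition ngon_vertex (R : realType) (N : nat) (rho : R) (k : nat) : R * R :=
  (rho * cos (k%:R * (2 * pi) / N%:R), rho * sin (k%:R * (2 * pi) / N%:R)).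

(* Main.v *)
Require Import Defs.
From HB Require Import structures.
From mathcomp Require Import ring lra zify.

Set Implicit Arguments.
Unset Strict Implicit.
Unset Printing Implicit Defensive.

Import Order.TTheory GRing.Theory Num.Theory.

Local Open Scope ring_scope.

(** In the isotropic coordinates u = x1 + i x2 and v = x1 - i x2 one has
    q2 = u v, so q2^s = u^s v^s is a single monomial. Comparing coefficients,
    sum_j (a_j u + b_j v)^(2s) = q2^s says that all the moments
    sum_j a_j^m b_j^(2s-m), 0 <= m <= 2s, vanish except the central one, m = s,
    which equals c = 1 / binomial(2s, s) (decomposition_moments).

    Let V be the matrix with entries a_j^m b_j^(s-m), one row for each summand
    and one column for each 0 <= m <= s, and let W be V with a and b exchanged.
    The moment conditions amount to V^T W = c I (central_momentsP), so that V^T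
    has a right inverse and there are at least s+1 summands. With exactly s+1
    summands V and W are square, and the condition is equivalent to W V^T = c I
    (central_moments_dual). The entries of this product are geometric sums:
    on the diagonal they give (s+1) (a_j b_j)^s = c, and off the diagonal they
    say that a_j b_l and b_j a_l are distinct with equal (s+1)-th powers
    (central_moments_roots). Hence the ratios a_j / b_j are all the (s+1)-th
    roots of one nonzero number T.

    The rotation u -> lam u, v -> lam^-1 v multiplies T by lam^(2(s+1)), so a
    suitable lam carries the ratios of one decomposition onto those of any other
    one. Since (a_j b_j)^s is prescribed, the ratio a_j / b_j determines the
    summand (a_j u + b_j v)^(2s), and two decompositions with the same ratios
    have the same summands up to order (central_moments_torus).

    Finally, the form r cos(tau) x1 + r sin(tau) x2 has isotropic coefficients
    (r/2) e^(-i tau) and (r/2) e^(i tau). The value of r makes the diagonal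
    condition hold, and the angles tau_j make the ratios e^(-2 i tau_j) run
    through the (s+1)-th roots of unity; by the equivalence above this already
    proves the regular decomposition (regular_moments). *)

(** * Moments of binary powers and matrix duality *)

Section Moments.
Variables (F : fieldType) (s : nat).

Definition monomial_mx k (a b : 'I_k -> F) : 'M[F]_(k, s.+1) :=
  \matrix_(j, m) (a j ^+ m * b j ^+ (s - m)).

Definition central_moments k (c : F) (a b : 'I_k -> F) : Prop :=
  forall m, (m <= 2 * s)%N ->
    \sum_(j < k) a j ^+ m * b j ^+ (2 * s - m) = c *+ (m == s).

(** The entry (m, n) of the product is the moment of index s + m - n: the matrix
    is a Toeplitz arrangement of the moments, in which the central one fills
    the diagonal. *)
Lemma central_momentsP k c (a b : 'I_k -> F) :
  central_moments c a b <->
  (monomial_mx a b)^T *m monomial_mx b a = c%:M.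
Proof.
have entry (m n : 'I_s.+1) : ((monomial_mx a b)^T *m monomial_mx b a) m n =
    \sum_(j < k) a j ^+ (s + m - n) * b j ^+ (2 * s - (s + m - n)).
  rewrite mxE; apply: eq_bigr => j _.
  rewrite !mxE [b j ^+ n * _]mulrC mulrACA -!exprD.
  by congr (_ ^+ _ * _ ^+ _); have := ltn_ord m; have := ltn_ord n; lia.
split=> [mom | gram m lem].
  apply/matrixP => m n; rewrite entry mom; last by have := ltn_ord m; lia.
  by rewrite !mxE; congr (_ *+ _); rewrite -val_eqE /=; have := ltn_ord n; lia.
(* Truncated subtraction picks an entry on the border: in the first column if
   s <= m, in the first row otherwise. *)
have lt1 : (m - s < s.+1)%N by lia.
have lt2 : (s - m < s.+1)%N by lia.
have := entry (Ordinal lt1) (Ordinal lt2); rewrite gram !mxE /= -val_eqE /=.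
have -> : (s + (m - s) - (s - m) = m)%N by lia.
by move <-; congr (_ *+ _); lia.
Qed.

Lemma central_moments_leq k c (a b : 'I_k -> F) :
  c != 0 -> central_moments c a b -> (s.+1 <= k)%N.
Proof.
move=> c0 /central_momentsP gram.
apply: (@mulmx1_min F _ _ (c^-1 *: (monomial_mx a b)^T) (monomial_mx b a)).
by rewrite -scalemxAl gram scale_scalar_mx mulVf.
Qed.

(** With as many summands as columns, the two matrices are inverse to each other
    up to the scalar c, hence may be multiplied in the other order: relations
    involving all summands at once become relations between pairs of them. *)
Lemma central_moments_dual c (a b : 'I_s.+1 -> F) : c != 0 ->
  central_moments c a b <->
  forall j l, \sum_(m < s.+1) (b j * a l) ^+ (s - m) * (a j * b l) ^+ m
              = c *+ (j == l).
Proof.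
move=> c0; rewrite central_momentsP.
have comm (A B : 'M[F]_s.+1) : A *m B = c%:M -> B *m A = c%:M.
  move=> AB; have: (c^-1 *: A) *m B = 1%:M.
    by rewrite -scalemxAl AB scale_scalar_mx mulVf.
  move/mulmx1C; rewrite -scalemxAr => BA.
  by rewrite -[LHS]scale1r -(mulfV c0) -scalerA BA scale_scalar_mx mulr1.
have entry j l : (monomial_mx b a *m (monomial_mx a b)^T) l j =
    \sum_(m < s.+1) (b j * a l) ^+ (s - m) * (a j * b l) ^+ m.
  by rewrite mxE; apply: eq_bigr => m _; rewrite !mxE !exprMn; ring.
split=> [/comm dual j l | dual].
  by rewrite -entry dual mxE eq_sym.
by apply/comm/matrixP => l j; rewrite entry dual mxE eq_sym.
Qed.

Lemma pow_mulrSn_neq0 (x c : F) :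
  c != 0 -> (0 < s)%N -> x ^+ s *+ s.+1 = c -> x != 0.
Proof.
move=> c0 s0 xE; apply: contra_neq c0 => x0.
by rewrite -xE x0 expr0n gtn_eqF // mul0rn.
Qed.

(** The dual sums are the cofactors of X - Y in X^(s+1) - Y^(s+1), with
    X = a_j b_l and Y = b_j a_l; when X = Y they degenerate to (s+1) X^s. *)
Lemma central_moments_roots c (a b : 'I_s.+1 -> F) : c != 0 -> (0 < s)%N ->
  central_moments c a b <->
  (forall j, (a j * b j) ^+ s *+ s.+1 = c)
  /\ forall j l, j != l -> a j * b l != b j * a l /\
     (a j * b l) ^+ s.+1 = (b j * a l) ^+ s.+1.
Proof.
move=> c0 s0; rewrite central_moments_dual //.
have diag j : \sum_(m < s.+1) (b j * a j) ^+ (s - m) * (a j * b j) ^+ m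
    = (a j * b j) ^+ s *+ s.+1.
  rewrite -[in RHS](card_ord s.+1) -sumr_const; apply: eq_bigr => m _.
  by rewrite mulrC [b j * _]mulrC -exprD subnKC // -ltnS.
split=> [dual | [eqc root] j l].
  have abE j : (a j * b j) ^+ s *+ s.+1 = c by rewrite -diag dual eqxx.
  have ab0 j : a j * b j != 0 := pow_mulrSn_neq0 c0 s0 (abE j).
  split=> // j l jl; have := dual j l; rewrite (negPf jl) => sum0.
  split; last first.
    by apply/esym/eqP; rewrite -subr_eq0 subrXX /= sum0 mulr0.
  apply: contra_neq c0 => eq_ab.
  (* Equal cross products would turn the vanishing sum into (s+1) X^s with X
     nonzero, so s+1 would vanish in F, and c with it. *)
  have /eqP: (a j * b l) ^+ s *+ s.+1 = 0.
    rewrite -[RHS]sum0 -eq_ab -[in LHS](card_ord s.+1) -sumr_const.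
    apply: eq_bigr => m _.
    by rewrite -exprD subnK // -ltnS.
  rewrite -mulr_natr mulf_eq0 => /orP [|/eqP s10]; last first.
    by rewrite -(abE j) -mulr_natr s10 mulr0.
  rewrite expf_eq0 s0 /= mulf_eq0.
  have := ab0 j; have := ab0 l; rewrite !mulf_eq0.
  by move=> /norP [_ /negPf->] /norP [/negPf-> _].
case: eqVneq => [<-|jl]; first by rewrite diag eqc.
have [neq eqX] := root j l jl.
have /eqP := subrXX (b j * a l) (a j * b l) s.+1.
rewrite eqX subrr eq_sym mulf_eq0 subr_eq0 [_ == a j * b l]eq_sym (negPf neq) /=.
by move=> /eqP.
Qed.

Lemma central_moments_ratios c (a b : 'I_s.+1 -> F) : c != 0 -> (0 < s)%N ->
  central_moments c a b ->
  [/\ forall j, a j != 0, forall j, b j != 0,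
      injective (fun j => a j / b j) &
      forall j l, (a j / b j) ^+ s.+1 = (a l / b l) ^+ s.+1].
Proof.
move=> c0 s0 /(central_moments_roots a b c0 s0) [abE ab_root].
have ab0 j : a j * b j != 0 := pow_mulrSn_neq0 c0 s0 (abE j).
have a0 j : a j != 0 by have := ab0 j; rewrite mulf_eq0 => /norP [].
have b0 j : b j != 0 by have := ab0 j; rewrite mulf_eq0 => /norP [].
split=> // [j l|j l].
  move=> /eqP; rewrite eqr_div // => /eqP eq_ab; apply/eqP.
  by apply: contraT => /ab_root [] /eqP []; rewrite eq_ab mulrC.
have [->//|/ab_root [_]] := eqVneq j l.
rewrite !exprMn !exprVn => eq_ab; apply/eqP.
by rewrite eqr_div ?expf_neq0 // eq_ab mulrC.
Qed.
End Moments.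

(** A polynomial of degree at most n has at most n roots, so both families
    enumerate its whole set of roots. *)
Lemma roots_permutation (F : fieldType) (n : nat) (p : {poly F})
    (f g : 'I_n -> F) :
  p != 0 -> (size p <= n.+1)%N -> injective f -> injective g ->
  (forall j, root p (f j)) -> (forall j, root p (g j)) ->
  exists sigma : 'S_n, forall j, f (sigma j) = g j.
Proof.
move=> p0 szp finj ginj rf rg.
have hit j : exists l, f l == g j.
  have [/existsP //|/existsPn miss] := boolP [exists l, f l == g j].
  exfalso.
  suff: (size (g j :: codom f) < size p)%N.
    by move=> /leq_trans/(_ szp); rewrite /= size_codom card_ord ltnn.
  apply: max_poly_roots => //=.
    by rewrite rg; apply/allP => _ /codomP [l ->].
  rewrite map_inj_uniq ?enum_uniq // andbT.
  by apply/negP => /codomP [l gl]; have := miss l; rewrite gl eqxx.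
have hinj : injective (fun j => xchoose (hit j)).
  move=> j l e; apply: ginj.
  by rewrite -(eqP (xchooseP (hit j))) e (eqP (xchooseP (hit l))).
by exists (perm hinj) => j; rewrite permE; apply/eqP/(xchooseP (hit j)).
Qed.

(** * Decompositions in isotropic coordinates *)

Local Open Scope complex_scope.

Section IsotropicCoordinates.
Variable R : realType.
Local Notation C := R[i].
Implicit Types p q lam : C.

Definition isotropic_form p q : {mpoly C[2]} :=
  p *: (x1 + 'i *: x2) + q *: (x1 - 'i *: x2).

Lemma isotropic_formE p q :
  isotropic_form p q = (p + q) *: x1 + ('i * (p - q)) *: x2.
Proof. by rewrite /isotropic_form -!mul_mpolyC; ring. Qed.

Lemma q2E : q2 R = (x1 + 'i *: x2) * (x1 - 'i *: x2).
Proof.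
rewrite /q2 -!mul_mpolyC mulrC -subr_sqr exprMn -rmorphXn /= sqr_i.
by rewrite rmorphN1 mulN1r opprK.
Qed.

Lemma isotropic_form_homog p q : isotropic_form p q \is 1.-homog.
Proof. by rewrite isotropic_formE rpredD // rpredZ //= dhomogX /= mdeg1. Qed.

Lemma homog1_isotropic (ell : {mpoly C[2]}) :
  ell \is 1.-homog -> exists p q, ell = isotropic_form p q.
Proof.
move=> hom.
have -> : ell = ell@_U_(ord0) *: x1 + ell@_U_(ord_max) *: x2.
  apply/mpolyP => m; rewrite mcoeffD !mcoeffZ !mcoeffX.
  have [/mdeg1P [i /eqP ->]|] := boolP (mdeg m == 1%N); last first.
    move=> m1; rewrite (dhomog_nemf_coeff hom m1).
    have ne i : (U_(i)%MM == m) = false.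
      by apply/eqP => e; rewrite -e mdeg1 in m1.
    by rewrite !ne !mulr0 addr0.
  rewrite !eq_mnm1.
  case: i => [[|[|//]] lti].
    by rewrite (_ : Ordinal _ = ord0) ?mulr1 ?mulr0 ?addr0 //; apply: val_inj.
  by rewrite (_ : Ordinal _ = ord_max) ?mulr1 ?mulr0 ?add0r //; apply: val_inj.
set a := ell@__; set b := ell@__.
exists ((a - 'i * b) / 2), ((a + 'i * b) / 2); rewrite isotropic_formE.
congr (_ *: _ + _ *: _); first by field.
transitivity (- 'i ^+ 2 * b); first by rewrite sqr_i opprK mul1r.
by field.
Qed.

(** The substitution u = 'X, v = 1, expressed through x1 = (u + v) / 2 and
    x2 = (u - v) / (2 i). It identifies binary forms of a given degree with
    univariate polynomials, where coefficients can be compared. *)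
Definition dehomogenize : {mpoly C[2]} -> {poly C} :=
  mmap (@polyC C)
   (fun i => if i == ord0 then 2^-1 *: ('X + 1) else (2 * 'i)^-1 *: ('X - 1)).

HB.instance Definition _ := GRing.RMorphism.on dehomogenize.

Lemma dehomogenize_isotropic p q :
  dehomogenize (isotropic_form p q) = p *: 'X + q%:P.
Proof.
rewrite isotropic_formE rmorphD /= /dehomogenize !mmapZ !mmapX !mmap1U /=.
rewrite -!mul_polyC !mulrA -!polyCM.
have -> : 'i * (p - q) * (2 * 'i)^-1 = (p - q) / 2.
  by field; apply: neq0Ci.
have /(congr1 (@polyC _)) pE : (p + q) / 2 + (p - q) / 2 = p by field.
have /(congr1 (@polyC _)) qE : (p + q) / 2 - (p - q) / 2 = q by field.
rewrite -[in RHS]pE -[in RHS]qE polyCD polyCB; ring.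
Qed.

Lemma dehomogenize_q2 : dehomogenize (q2 R) = 'X.
Proof.
have uE : x1 + 'i *: x2 = isotropic_form 1 0.
  by rewrite /isotropic_form scale1r scale0r addr0.
have vE : x1 - 'i *: x2 = isotropic_form 0 1.
  by rewrite /isotropic_form scale1r scale0r add0r.
rewrite q2E uE vE.
move: (dehomogenize_isotropic 1 0) (dehomogenize_isotropic 0 1).
move: (isotropic_form 1 0) (isotropic_form 0 1) => U V UE VE.
by rewrite rmorphM /= UE VE scale1r scale0r addr0 add0r mulr1.
Qed.

Lemma coef_isotropicX p q n m : (m <= n)%N ->
  (dehomogenize (isotropic_form p q ^+ n))`_m
  = p ^+ m * q ^+ (n - m) * 'C(n, m)%:R.
Proof.
rewrite -ltnS => ltm; rewrite rmorphXn /= dehomogenize_isotropic addrC exprDn.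
rewrite coef_sum (bigD1 (Ordinal ltm)) //= big1 ?addr0 => [|l].
  rewrite exprZn -polyC_exp coefMn coefCM coefZ coefXn eqxx mulr1.
  by rewrite mulr_natr [p ^+ _ * _]mulrC.
rewrite -val_eqE /= eq_sym => /negPf lm.
by rewrite exprZn -polyC_exp coefMn coefCM coefZ coefXn lm !mulr0 mul0rn.
Qed.

(** Both sides are expanded in the monomials u^m v^(2s-m): the m-th coefficient
    is the m-th moment times binomial(2s, m), and q2^s is the middle monomial.
    The converse implication is a computation with u and v themselves; the
    direct one separates the coefficients by setting v = 1. *)
Lemma decomposition_moments s k (a b : 'I_k -> C) :
  is_power_decomposition (2 * s) (q2 R ^+ s)
    (fun j => isotropic_form (a j) (b j)) <->
  central_moments s ('C(2 * s, s)%:R^-1) a b.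
Proof.
have binC0 m : (m <= 2 * s)%N -> 'C(2 * s, m)%:R != 0 :> C.
  by move=> le; rewrite pnatr_eq0 -lt0n bin_gt0.
split=> [[_ eqf] m lem | mom].
  have /(congr1 (fun f => (dehomogenize f)`_m)) := eqf.
  rewrite rmorphXn /= dehomogenize_q2 coefXn.
  rewrite rmorph_sum coef_sum.
  under [X in _ = X -> _]eq_bigr do rewrite coef_isotropicX //.
  rewrite -mulr_suml => sumE.
  apply: (mulIf (binC0 m lem)); rewrite -sumE.
  case: eqVneq => [->|]; last by rewrite mul0r.
  by rewrite mulVf ?binC0 //; lia.
split=> [j|]; first exact: isotropic_form_homog.
transitivity (\sum_(m < (2 * s).+1)
   ((\sum_(j < k) a j ^+ m * b j ^+ (2 * s - m)) *+ 'C(2 * s, m)) *: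
   ((x1 - 'i *: x2) ^+ (2 * s - m) * (x1 + 'i *: x2) ^+ m)); last first.
  under [RHS]eq_bigr do rewrite /isotropic_form addrC exprDn.
  rewrite exchange_big /=; apply: eq_bigr => m _.
  rewrite -sumrMnl scaler_suml; apply: eq_bigr => j _.
  by rewrite !exprZn -scalerAl -scalerAr scalerA -scalerMnl mulrC.
have lts : (s < (2 * s).+1)%N by lia.
rewrite (bigD1 (Ordinal lts)) //= [X in _ + X]big1 ?addr0; last first.
  move=> m; rewrite -val_eqE /= => /negPf ms.
  by rewrite mom ?ms ?mul0rn ?scale0r // -ltnS.
rewrite mom // eqxx -[X in X *: _]mulr_natr mulVf ?binC0 // scale1r.
by rewrite q2E exprMn mulrC; congr (_ ^+ _ * _); lia.
Qed.

(** The matrix of u -> lam u, v -> lam^-1 v in the coordinates x1 and x2, that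
    is, the rotation of angle t with lam = e^(-i t), for a complex angle t. *)
Definition isotropic_rotation (lam : C) : 'M[C]_2 :=
  \matrix_(k, l) if k == l then (lam + lam^-1) / 2
                 else (-1) ^+ l * ('i * (lam - lam^-1) / 2).

Lemma isotropic_rotation_orthogonal lam :
  lam != 0 -> orthogonal_mx (isotropic_rotation lam).
Proof.
move=> lam0; apply/eqP/matrixP => k l.
have unit_norm : ((lam + lam^-1) / 2) ^+ 2 + ('i * (lam - lam^-1) / 2) ^+ 2 = 1.
  rewrite !exprMn sqr_i.
  by field.
rewrite !mxE !big_ord_recl big_ord0 !mxE.
move: unit_norm; set c := (lam + lam^-1) / 2; set d := 'i * _ / 2.
case: k l => [[|[|//]] ?] [[|[|//]] ?] /= cd1; rewrite ?expr0 ?expr1.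
- by rewrite -[RHS]cd1; ring.
- by ring.
- by ring.
- by rewrite -[RHS]cd1; ring.
Qed.

Lemma linear_change_isotropic lam p q :
  linear_change (isotropic_rotation lam) (isotropic_form p q)
  = isotropic_form (lam * p) (lam^-1 * q).
Proof.
rewrite !isotropic_formE /linear_change /comp_mpoly mmapD !mmapZ !mmapX !mmap1U.
rewrite !tnth_mktuple !big_ord_recl !big_ord0 !mxE /= !mul_mpolyC !addr0.
rewrite (_ : lift _ _ = ord_max); last exact: val_inj.
rewrite !scalerDr !scalerA addrACA -!scalerDl expr0 expr1.
have ii : 'i * 'i = -1 :> C by rewrite -expr2 sqr_i.
move: (lam^-1) => mu.
congr (_ *: _ + _ *: _).
  rewrite (_ : _ + _ = (p + q) * (lam + mu) / 2 -
     ('i * 'i) * (p - q) * (lam - mu) / 2); last by field.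
  by rewrite ii; field.
by field.
Qed.

(** Proportional linear forms with factor mu have products of coefficients that
    differ by mu^2, so the hypothesis on s-th powers reads mu^(2s) = 1. *)
Lemma isotropic_form_pow_eq s p q p' q' :
  p * q != 0 -> (p * q) ^+ s = (p' * q') ^+ s -> p * q' = q * p' ->
  isotropic_form p q ^+ (2 * s) = isotropic_form p' q' ^+ (2 * s).
Proof.
rewrite mulf_eq0 => /norP [p0 q0] eqs cross.
pose mu := p' / p.
have -> : p' = mu * p by rewrite /mu divfK.
have eq' : q' = mu * q by rewrite /mu mulrAC [p' * q]mulrC -cross mulrC mulKf.
have -> : isotropic_form (mu * p) q' = mu *: isotropic_form p q.
  by rewrite /isotropic_form [RHS]scalerDr !scalerA eq'.
suff mu1 : mu ^+ (2 * s) = 1 by rewrite exprZn mu1 scale1r.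
have pqs0 : (p * q) ^+ s != 0 by rewrite expf_neq0 // mulf_neq0.
apply: (mulIf pqs0); rewrite mul1r [RHS]eqs exprM -exprMn; congr (_ ^+ _).
by rewrite eq' /mu; field.
Qed.

Lemma power_decomposition_coefs s k (ell : 'I_k -> {mpoly C[2]}) :
  is_power_decomposition (2 * s) (q2 R ^+ s) ell ->
  exists a b : 'I_k -> C, (forall j, ell j = isotropic_form (a j) (b j))
    /\ central_moments s ('C(2 * s, s)%:R^-1) a b.
Proof.
move=> [hom sumE].
have ab j : exists ab : C * C, ell j == isotropic_form ab.1 ab.2.
  by have [p [q ->]] := homog1_isotropic (hom j); exists (p, q).
have ellE j := eqP (xchooseP (ab j)).
exists (fun j => (xchoose (ab j)).1), (fun j => (xchoose (ab j)).2).
split=> //; apply/decomposition_moments.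
split=> [j|]; first exact: isotropic_form_homog.
by rewrite sumE; apply: eq_bigr => j _; congr (_ ^+ _); apply: ellE.
Qed.

(** Uniqueness up to rotation: any two families of ratios are full sets of
    (s+1)-th roots, of some T and of some T', and rescaling by lam^2 with
    lam^(2(s+1)) = T' / T maps the first set onto the second. *)
Lemma central_moments_torus s (c : C) (a b a' b' : 'I_s.+1 -> C) :
  c != 0 -> (0 < s)%N -> central_moments s c a b -> central_moments s c a' b' ->
  exists2 lam : C, lam != 0 & exists sigma : 'S_s.+1, forall j,
    isotropic_form (lam * a (sigma j)) (lam^-1 * b (sigma j)) ^+ (2 * s)
    = isotropic_form (a' j) (b' j) ^+ (2 * s).
Proof.
move=> c0 s0 mom mom'.
have [abE _] := (central_moments_roots a b c0 s0).1 mom.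
have [abE' _] := (central_moments_roots a' b' c0 s0).1 mom'.
have [a0 b0 t_inj t_pow] := central_moments_ratios c0 s0 mom.
have [a0' b0' t_inj' t_pow'] := central_moments_ratios c0 s0 mom'.
pose T := (a ord0 / b ord0) ^+ s.+1; pose T' := (a' ord0 / b' ord0) ^+ s.+1.
have T0 : T != 0 by rewrite expf_neq0 // mulf_neq0 ?invr_neq0.
have T0' : T' != 0 by rewrite expf_neq0 // mulf_neq0 ?invr_neq0.
pose lam : C := (2 * s.+1).-root (T' / T).
have lamX : lam ^+ (2 * s.+1) = T' / T by rewrite rootCK.
have lam0 : lam != 0.
  have : T' / T != 0 by rewrite mulf_neq0 ?invr_neq0.
  by rewrite -lamX expf_eq0.
exists lam => //.
have rootT' (z : C) : z ^+ s.+1 = T' -> root ('X^(s.+1) - T'%:P) z.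
  by move=> zT'; rewrite rootE !hornerE zT' subrr.
have [||||j|j|sigma sigmaE] := @roots_permutation _ s.+1 ('X^(s.+1) - T'%:P)
    (fun j => lam ^+ 2 * (a j / b j)) (fun j => a' j / b' j).
- by rewrite -size_poly_eq0 size_XnsubC.
- by rewrite size_XnsubC.
- by move=> j l /(mulfI (expf_neq0 2 lam0)); apply: t_inj.
- exact: t_inj'.
- by apply: rootT'; rewrite exprMn -exprM lamX (t_pow _ ord0) divfK.
- by apply: rootT'; rewrite (t_pow' _ ord0).
exists sigma => j.
have abs : (a (sigma j) * b (sigma j)) ^+ s = (a' j * b' j) ^+ s.
  have s1 : s.+1%:R != 0 :> C by rewrite pnatr_eq0.
  by apply: (mulIf s1); rewrite !mulr_natr abE abE'.
have lam_ab : lam * a (sigma j) * (lam^-1 * b (sigma j))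
              = a (sigma j) * b (sigma j) by rewrite mulrACA mulfV // mul1r.
apply: isotropic_form_pow_eq; rewrite ?lam_ab //; first by rewrite mulf_neq0.
have /eqP := sigmaE j; rewrite mulrA eqr_div // => /eqP cross.
apply: (mulfI lam0); rewrite !mulrA -expr2 cross mulfV // mul1r.
by rewrite mulrC.
Qed.

End IsotropicCoordinates.

(** * The regular polygon *)

Section RegularPolygon.
Variables (R : realType) (s : nat).
Hypothesis s_gt0 : (0 < s)%N.
Local Notation C := R[i].

Definition cis (x : R) : C := cos x +i* sin x.

Lemma cisD x y : cis (x + y) = cis x * cis y.
Proof.
by apply/eqP; rewrite eq_complex /= cosD sinD eqxx /=; apply/eqP; ring.
Qed.

Lemma cis0 : cis 0 = 1.
Proof. by rewrite /cis cos0 sin0. Qed.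

Lemma cisX x n : cis x ^+ n = cis (n%:R * x).
Proof.
elim: n => [|n IH]; first by rewrite mul0r cis0.
by rewrite exprS IH -cisD -natr1 mulrDl mul1r addrC.
Qed.

Lemma sin_natpi n : sin (n%:R * pi) = 0 :> R.
Proof.
elim: n => [|n IH]; first by rewrite mul0r sin0.
by rewrite -natr1 mulrDl mul1r sinDpi IH oppr0.
Qed.

Lemma radius_half_pow :
  (radius R s / 2) ^+ (2 * s) = (s.+1%:R * 'C(2 * s, s)%:R)^-1.
Proof.
have rootX (a : R) : 0 <= a -> (a `^ (- (1 / (2 * s%:R)))) ^+ (2 * s) = a^-1.
  move=> a0; rewrite -powR_mulrn ?powR_ge0 // -powRrM natrM -[RHS]powR_inv1 //.
  by congr (_ `^ _); field; rewrite pnatr_eq0 -lt0n.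
have -> : radius R s / 2 =
   s.+1%:R `^ (- (1 / (2 * s%:R))) * 'C(2 * s, s)%:R `^ (- (1 / (2 * s%:R))).
  by rewrite /radius; field.
by rewrite exprMn !rootX ?ler0n // invfM.
Qed.

(** For e = -1 and e = 1, the coefficients of u and v in the j-th form of the
    regular decomposition. *)
Definition tau_coef (e : R) (j : nat) : C :=
  (radius R s / 2)%:C * cis (e * tau R s j).

Lemma tau_coefM d e j l :
  tau_coef d j * tau_coef e l
  = ((radius R s / 2) ^+ 2)%:C * cis (d * tau R s j + e * tau R s l).
Proof. by rewrite cisD rmorphXn /tau_coef /=; ring. Qed.

Lemma real_linear_form_isotropic j :
  real_linear_form (tau_point R s j) =
  isotropic_form (tau_coef (-1) j) (tau_coef 1 j).
Proof.
rewrite isotropic_formE /real_linear_form /tau_coef !mul1r !mulN1r /=.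
by congr (_ *: _ + _ *: _); apply/eqP; rewrite eq_complex /= cosN sinN;
  apply/andP; split; apply/eqP; field.
Qed.

(** The angles lie in [0, pi), so two of them differ by less than pi. *)
Lemma sin_tauB (j l : 'I_s.+1) : j != l -> sin (tau R s j - tau R s l) != 0.
Proof.
wlog lt_lj : j l / (l < j)%N => [th jl|_].
  have [lt|lt|e] := ltngtP l j; first exact: th.
    by rewrite -opprB sinN oppr_eq0 th // eq_sym.
  by move: jl; rewrite -val_eqE /= e eqxx.
rewrite gt_eqF // sin_gt0_pi // /tau -mulrBl -mulrBl.
have n0 : 0 < s.+1%:R :> R by rewrite ltr0n.
rewrite ltr_pdivrMr // divr_gt0 ?mulr_gt0 ?pi_gt0 ?subr_gt0 ?ltr_nat //=.
rewrite mulrC ltr_pM2l ?pi_gt0 // -natrB ?ltr_nat ?(ltnW lt_lj) //.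
exact: leq_ltn_trans (leq_subr _ _) (ltn_ord j).
Qed.

(** With x = tau_j - tau_l, the two cross products are (r/2)^2 e^(-i x)
    and (r/2)^2 e^(i x). They differ because sin x is nonzero, and their
    (s+1)-th powers agree because (s+1) x is an integral multiple of pi. *)
Lemma regular_moments :
  central_moments s ('C(2 * s, s)%:R^-1)
    (fun j : 'I_s.+1 => tau_coef (-1) j) (fun j : 'I_s.+1 => tau_coef 1 j).
Proof.
have binC0 : 'C(2 * s, s)%:R != 0 :> R.
  by rewrite pnatr_eq0 -lt0n bin_gt0 leq_pmull.
have s1 : s.+1%:R != 0 :> R by rewrite pnatr_eq0.
apply/central_moments_roots => //.
  by rewrite invr_neq0 // pnatr_eq0 -lt0n bin_gt0 leq_pmull.
split=> [j|j l jl].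
  rewrite tau_coefM -mulrDl addNr mul0r cis0 mulr1 -rmorphXn /= -exprM.
  rewrite radius_half_pow -rmorphMn /= -mulr_natr invfM mulrAC mulVf // mul1r.
  by rewrite fmorphV rmorph_nat.
rewrite !tau_coefM !mulN1r !mul1r addrC -[tau R s l - _]opprB.
set x := tau R s j - tau R s l; set rho2 := (_ ^+ 2)%:C.
have rho20 : rho2 != 0.
  apply/negP; rewrite fmorph_eq0 expf_eq0 /= => /eqP rho0.
  move/eqP: radius_half_pow; rewrite rho0 expr0n (_ : (2 * s)%N == 0%N = false).
    by rewrite eq_sym invr_eq0 mulf_eq0 (negPf s1) (negPf binC0).
  by apply/negbTE; rewrite muln_eq0 -lt0n.
have sinx0 : sin x != 0 := sin_tauB jl.
have sin_nx : sin (s.+1%:R * x) = 0.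
  have -> : s.+1%:R * x = j%:R * pi - l%:R * pi.
    by rewrite /x /tau -mulrBl mulrC divfK.
  by rewrite sinB !sin_natpi mul0r mulr0 subr0.
split.
  rewrite (inj_eq (mulfI rho20)); apply: contra_neq sinx0 => -[_].
  by rewrite sinN => sinE; lra.
by rewrite !exprMn !cisX mulrN /cis cosN sinN sin_nx oppr0.
Qed.
End RegularPolygon.

Lemma tau_point_ngon (R : realType) (s j : nat) :
  tau_point R s j = ngon_vertex (2 * s.+1) (radius R s) j
  /\ - tau_point R s j = ngon_vertex (2 * s.+1) (radius R s) (j + s.+1).
Proof.
have s1 : s.+1%:R != 0 :> R by rewrite pnatr_eq0.
have tauE : j%:R * (2 * pi) / (2 * s.+1)%:R = tau R s j.
  by rewrite /tau natrM; move: s.+1 s1 => n n0; field.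
have tauDpi : (j + s.+1)%:R * (2 * pi) / (2 * s.+1)%:R = tau R s j + pi.
  by rewrite /tau natrM natrD; move: s.+1 s1 => n n0; field.
by rewrite /ngon_vertex tauE tauDpi cosDpi sinDpi !mulrN; split.
Qed.

Local Close Scope complex_scope.

Theorem theorem4p23 (R : realType) (s : nat) (hs : (1 <= s)%N) :
  [/\ (* the real decomposition of size s+1 *)
      is_power_decomposition (2 * s) (q2 R ^+ s)
        (fun j : 'I_s.+1 => real_linear_form (tau_point R s j)),
      (* s+1 is the minimal size *)
      forall (k : nat) (ell : 'I_k -> {mpoly R[i][2]}),
        is_power_decomposition (2 * s) (q2 R ^+ s) ell -> (s.+1 <= k)%N,
      (* uniqueness up to complex orthogonal transformations *)
      forall ell : 'I_s.+1 -> {mpoly R[i][2]},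
        is_power_decomposition (2 * s) (q2 R ^+ s) ell ->
        exists2 A : 'M[R[i]]_2, orthogonal_mx A &
        exists sigma : 'S_s.+1, forall j : 'I_s.+1,
          linear_change A (ell (sigma j)) ^+ (2 * s)
          = real_linear_form (tau_point R s j) ^+ (2 * s)
    & (* the terms are the pairs of opposite vertices of a regular 2(s+1)-gon *)
      forall j : 'I_s.+1,
        tau_point R s j = ngon_vertex (2 * s.+1) (radius R s) j
        /\ - tau_point R s j = ngon_vertex (2 * s.+1) (radius R s) (j + s.+1)].
Proof.
have c0 : 'C(2 * s, s)%:R^-1 != 0 :> R[i].
  by rewrite invr_neq0 // pnatr_eq0 -lt0n bin_gt0 leq_pmull.
have regular := regular_moments R hs.
split=> [| k ell /power_decomposition_coefs [a [b [_ mom]]]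
         | ell /power_decomposition_coefs [a [b [ellE mom]]] | j].
- have [hom sumE] := (decomposition_moments _ _ _).2 regular.
  split=> [j|]; first by rewrite real_linear_form_isotropic.
  by rewrite sumE; apply: eq_bigr => j _; rewrite real_linear_form_isotropic.
- exact: central_moments_leq c0 mom.
- have [lam lam0 [sigma sigmaE]] := central_moments_torus c0 hs mom regular.
  exists (isotropic_rotation lam); first exact: isotropic_rotation_orthogonal.
  exists sigma => j.
  by rewrite ellE linear_change_isotropic real_linear_form_isotropic sigmaE.
- exact: tau_point_ngon.
Qed.
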